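(* Let $\mu,\nu$ be finite measures on $\mathbb R$ with finite first moments such that $\mu\le_E\nu$. Define $\tilde P^\nu_\mu:\mathbb R\to\mathbb R$ by $\tilde P^\nu_\mu(k)=\min\{P_\nu(k),\,C_\nu(k)+(\mu(\mathbb R)k-\overline\mu)\}$. Then the counter-shadow $T^\nu(\mu)$ of $\mu$ in $\nu$ satisfies $P_{T^\nu(\mu)}=(\tilde P^\nu_\mu)^c$. In particular, $T^\nu(\mu)$ is the measure given by the second distributional derivative of $(\tilde P^\nu_\mu)^c$.
   Context: For a finite measure $\eta$ on $\mathbb R$ with finite first moment: $\overline\eta=\int x\,\eta(dx)$, $P_\eta(k)=\int(k-x)^+\eta(dx)$, $C_\eta(k)=\int(x-k)^+\eta(dx)$. For measures $\eta,\chi$: $\eta\le\chi$ means $\eta(A)\le\chi(A)$ for all Borel $A$; $\eta\le_{cx}\chi$ means $\int f\,d\eta\le\int f\,d\chi$ for all convex $f:\mathbb R\to\mathbb R$; $\eta\le_E\chi$ means $\int f\,d\eta\le\int f\,d\chi$ for all non-negative convex $f$. For $u:\mathbb R\to\mathbb R$, $u^c$ is the largest convex function below $u$. The counter-shadow $T^\nu(\mu)$ (for $\mu\le_E\nu$) is the measure, known to exist and be unique, such that $\mu\le_{cx}T^\nu(\mu)$, $T^\nu(\mu)\le\nu$, and every measure $\eta$ with $\mu\le_{cx}\eta\le\nu$ satisfies $\eta\le_{cx}T^\nu(\mu)$. *)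

(* Defs.v *)
From HB Require Import structures.
From mathcomp Require Import all_boot all_order all_algebra.
From mathcomp Require Import all_classical all_reals all_analysis.
Set Implicit Arguments. Unset Strict Implicit. Unset Printing Implicit Defensive.
Import Order.TTheory GRing.Theory Num.Theory.
Local Open Scope classical_set_scope.
Local Open Scope ring_scope.

Section Defs.
Variable R : realType.

Definition cs_finite_fm (eta : {measure set R -> \bar R}) : Prop :=
  (eta setT < +oo)%E /\ eta.-integrable setT (fun x => x%:E).

Definition cs_mass (eta : {measure set R -> \bar R}) : R := fine (eta setT).

Definition cs_mean (eta : {measure set R -> \bar R}) : R :=
  fine (\int[eta]_x x%:E)%E.

Definition cs_Pfun (eta : {measure set R -> \bar R}) (k : R) : R :=
  fine (\int[eta]_x (Num.max (k - x) 0)%:E)%E.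

Definition cs_Cfun (eta : {measure set R -> \bar R}) (k : R) : R :=
  fine (\int[eta]_x (Num.max (x - k) 0)%:E)%E.

Definition cs_convex_fun (f : R -> R) : Prop :=
  forall x y t : R, 0 <= t -> t <= 1 ->
    f (t * x + (1 - t) * y) <= t * f x + (1 - t) * f y.

Definition cs_meas_le (eta chi : {measure set R -> \bar R}) : Prop :=
  forall A : set R, measurable A -> (eta A <= chi A)%E.

Definition cs_cx_le (eta chi : {measure set R -> \bar R}) : Prop :=
  forall f : R -> R, cs_convex_fun f ->
    (\int[eta]_x (f x)%:E <= \int[chi]_x (f x)%:E)%E.

Definition cs_E_le (eta chi : {measure set R -> \bar R}) : Prop :=
  forall f : R -> R, cs_convex_fun f -> (forall x, 0 <= f x) ->
    (\int[eta]_x (f x)%:E <= \int[chi]_x (f x)%:E)%E.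

Definition cs_is_convex_hull (u h : R -> R) : Prop :=
  cs_convex_fun h /\ (forall k, h k <= u k) /\
  (forall g : R -> R, cs_convex_fun g -> (forall k, g k <= u k) ->
     forall k, g k <= h k).

Definition cs_is_counter_shadow (nu mu T : {measure set R -> \bar R}) : Prop :=
  cs_cx_le mu T /\ cs_meas_le T nu /\
  (forall eta : {measure set R -> \bar R},
     cs_cx_le mu eta -> cs_meas_le eta nu -> cs_cx_le eta T).

Definition cs_Ptilde (nu mu : {measure set R -> \bar R}) (k : R) : R :=
  Num.min (cs_Pfun nu k) (cs_Cfun nu k + (cs_mass mu * k - cs_mean mu)).

Definition cs_test_fun (phi : R -> R) : Prop :=
  (forall (n : nat) (x : R), derivable (iter n (@derive1 R R) phi) x 1) /\
  (exists a b : R, forall x, (x < a \/ b < x) -> phi x = 0).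

End Defs.

(* Main.v *)
(* The counter-shadow T of mu is also maximal in convex order among the measures
   eta <= nu with T <=_cx eta.  If a < c, nu - T charges both (-oo, a) and
   (c, +oo), and T charges [a, c], then a little mass of T can be moved from
   [a, c] to both sides so that mass and mean are kept and the result stays below
   nu; this strictly increases T in convex order, a contradiction.  Hence
   T [a, c] = 0 whenever P_T(a) < P_nu(a) and C_T(c) < C_nu(c).

   So let g be convex with g <= min(P_nu, C_nu + mu(R) k - mean mu).  At a point k
   where P_T = P_nu or C_T = C_nu, put-call parity gives g(k) <= P_T(k).
   Otherwise there are a < k < c at which the gaps P_nu - P_T and C_nu - C_T are
   positive but at most e; since T [a, c] = 0, P_T is affine on [a, c], and
   convexity of g gives g(k) <= P_T(k) + e.

   The distributional statement is Fubini's theorem applied to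
   phi(y) = \int (x - y)^+ phi''(x) dx. *)
Require Import Defs.
From HB Require Import structures.
From mathcomp Require Import all_boot all_order all_algebra.
From mathcomp Require Import all_classical all_reals all_analysis.
From mathcomp Require Import measurable_realfun ring lra.
Set Implicit Arguments.
Unset Strict Implicit.
Unset Printing Implicit Defensive.
Import Order.TTheory GRing.Theory Num.Theory.
Import numFieldNormedType.Exports.
Local Open Scope classical_set_scope.
Local Open Scope ring_scope.

(** * Convex functions on the line: measurability, chords, affine minorants *)

Section convexity.
Variable R : realType.
Implicit Types (f g : R -> R) (a c k x : R).

(** By convexity the strict sublevel sets are intervals, and the rays []-oo, y[] generate the Borel
    sets. *)
Lemma measurable_convex_fun f : cs_convex_fun f -> measurable_fun setT f.
Proof.
move=> cf; apply: (measurability _ (RGenInftyO.measurableE R)).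
move=> /= _ [_ [y ->] <-]; rewrite setTI; apply: is_interval_measurable.
move=> u v /= fu fv w /andP[uw wv]; move: fu fv; rewrite !in_itv/= => fu fv.
have [->//|uv] := eqVneq w u.
have uvlt : u < v by lra.
pose t := (v - w) / (v - u).
have t0 : 0 <= t by rewrite divr_ge0// subr_ge0// ltW.
have t1 : t <= 1 by rewrite ler_pdivrMr ?subr_gt0// mul1r; lra.
have wE : w = t * u + (1 - t) * v by rewrite /t; field; lra.
rewrite wE; apply: le_lt_trans (cf u v t t0 t1) _.
have [->|tn0] := eqVneq t 0; first by rewrite mul0r add0r subr0 mul1r.
have tgt : 0 < t by rewrite lt_neqAle eq_sym tn0.
nra.
Qed.

Lemma convex_fun_affine p q : cs_convex_fun (fun x : R => p * x + q).
Proof. by move=> x y t t0 t1; rewrite le_eqVlt; apply/orP; left; apply/eqP; ring. Qed.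

Lemma convex_fun_max f g : cs_convex_fun f -> cs_convex_fun g ->
  cs_convex_fun (fun x => Num.max (f x) (g x)).
Proof.
move=> cf cg x y t t0 t1; have t1' : 0 <= 1 - t by lra.
rewrite ge_max; apply/andP; split.
- apply: le_trans (cf x y t t0 t1) _.
  by apply: lerD; apply: ler_wpM2l => //; rewrite le_max lexx.
- apply: le_trans (cg x y t t0 t1) _.
  by apply: lerD; apply: ler_wpM2l => //; rewrite le_max lexx orbT.
Qed.

Lemma convex_fun_put k : cs_convex_fun (fun x : R => Num.max (k - x) 0).
Proof.
have -> : (fun x => Num.max (k - x) 0) = (fun x => Num.max (-1 * x + k) (0 * x + 0)).
  by apply/funext => x; congr Num.max; ring.
by apply: convex_fun_max; exact: convex_fun_affine.
Qed.

Lemma convex_fun_chord f a c x : cs_convex_fun f -> a < c -> a <= x <= c ->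
  f x <= f a + (f c - f a) / (c - a) * (x - a).
Proof.
move=> cf ac /andP[ax xc].
pose t := (c - x) / (c - a).
have t0 : 0 <= t by rewrite divr_ge0// subr_ge0// ltW.
have t1 : t <= 1 by rewrite ler_pdivrMr ?subr_gt0// mul1r; lra.
have xE : x = t * a + (1 - t) * c by rewrite /t; field; lra.
rewrite {1}xE; apply: le_trans (cf a c t t0 t1) _.
by rewrite le_eqVlt; apply/orP; left; apply/eqP; rewrite /t; field; lra.
Qed.

(** This is the chord inequality over the longer interval, [[x, c]] or [[a, x]], read at its
    interior point [a] or [c] and solved for [f x]. *)
Lemma convex_fun_chord_le f a c x : cs_convex_fun f -> a < c ->
  x <= a \/ c <= x -> f a + (f c - f a) / (c - a) * (x - a) <= f x.
Proof.
move=> cf ac [xa|cx].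
- have xc : x < c by exact: le_lt_trans ac.
  have ax : x <= a <= c by rewrite xa ltW.
  have := convex_fun_chord cf xc ax; set s := _ / (c - x).
  have sE : s * (c - x) = f c - f x by rewrite /s divfK//; lra.
  set r := _ / (c - a).
  have rE : r * (c - a) = f c - f a by rewrite /r divfK//; lra.
  have -> : r * (x - a) = - ((f c - f a) * (a - x) / (c - a)).
    by rewrite /r; field; lra.
  move=> h; rewrite -subr_ge0.
  have -> : f x - (f a - (f c - f a) * (a - x) / (c - a)) =
    (f x * (c - a) - f a * (c - a) + (f c - f a) * (a - x)) / (c - a).
    by field; lra.
  rewrite divr_ge0//; last lra.
  nra.
- have xc : a < x by exact: lt_le_trans cx.
  have ax : a <= c <= x by rewrite cx ltW.
  have := convex_fun_chord cf xc ax; set s := _ / (x - a).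
  have sE : s * (x - a) = f x - f a by rewrite /s divfK//; lra.
  set r := _ / (c - a).
  have -> : r * (x - a) = (f c - f a) * (x - a) / (c - a).
    by rewrite /r; field; lra.
  move=> h; rewrite -subr_ge0.
  have -> : f x - (f a + (f c - f a) * (x - a) / (c - a)) =
    ((f x - f a) * (c - a) - (f c - f a) * (x - a)) / (c - a).
    by field; lra.
  rewrite divr_ge0//; last lra.
  nra.
Qed.

(* Outside [0, 1] the chord over [0, 1] is below [f]; inside, convexity between
   [x] and [2] bounds how far [f] can drop below this chord. *)
Lemma convex_fun_affine_minorant f : cs_convex_fun f ->
  exists p q : R, forall x, p * x + q <= f x.
Proof.
move=> cf; pose s := f 1 - f 0.
pose psi x := f x - (f 0 + s * x).
have psi2 : 0 <= psi 2%:R.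
  have := @convex_fun_chord_le f 0 1 2%:R cf ltr01 (or_intror _).
  by rewrite /psi /s subr0 divr1 subr0 => h; rewrite subr_ge0; apply: h; lra.
exists s, (f 0 - psi 2%:R) => x.
have -> : s * x + (f 0 - psi 2%:R) = f 0 + s * x - psi 2%:R by ring.
have out : x <= 0 \/ 1 <= x -> f 0 + s * x <= f x.
  move=> hx; have := @convex_fun_chord_le f 0 1 x cf ltr01 hx.
  by rewrite subr0 divr1 subr0.
have [x0|x0] := leP x 0; first by have := out (or_introl x0); lra.
have [x1|x1] := leP 1 x; first by have := out (or_intror x1); lra.
have := @convex_fun_chord f x 2%:R 1 cf; rewrite ltW// (_ : 1 <= 2%:R)//; last lra.
have x2 : x < 2%:R by lra.
move=> /(_ x2 isT); set r := _ / _ => h.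
have rE : r * (2%:R - x) = f 2%:R - f x by rewrite /r divfK//; lra.
move: psi2; rewrite /psi /s => psi2.
nra.
Qed.

End convexity.

(** * Put and call functions of a measure with finite first moment, and first consequences of the
    two orders *)

Section first_moment.
Variable R : realType.
Implicit Types (m n : {measure set R -> \bar R}) (D : set R) (k x : R).

Lemma finite_fm_affine m p q : cs_finite_fm m ->
  m.-integrable setT (EFin \o (fun x : R => p * x + q)).
Proof.
move=> [mfin mx].
have mq : m.-integrable setT (EFin \o cst q).
  apply: measurable_bounded_integrable => //.
  exact: bounded_cst.
have -> : EFin \o (fun x : R => p * x + q) =
    (fun x : R => p%:E * x%:E)%E \+ (EFin \o cst q).
  by apply/funext => x /=; rewrite -EFinM -EFinD.
by apply: integrableD => //; exact: integrableZl.
Qed.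

Lemma integrable_RZl m D (r : R) f : measurable D ->
  m.-integrable D (EFin \o f) -> m.-integrable D (EFin \o (fun x => r * f x)).
Proof.
move=> mD mf; have -> : EFin \o (fun x => r * f x) = (fun x => r%:E * (EFin \o f) x)%E.
  by apply/funext => x /=; rewrite EFinM.
exact: integrableZl.
Qed.

Lemma integrable_RD m D f g : measurable D ->
  m.-integrable D (EFin \o f) -> m.-integrable D (EFin \o g) ->
  m.-integrable D (EFin \o (fun x => f x + g x)).
Proof. by move=> mD mf mg; exact: (integrableD mD mf mg). Qed.

Lemma measurable_put k : measurable_fun setT (fun x : R => Num.max (k - x) 0).
Proof. by apply: measurable_convex_fun; exact: convex_fun_put. Qed.

Lemma measurable_call k : measurable_fun setT (fun x : R => Num.max (x - k) 0).
Proof. by apply: measurable_maxr => //; exact: measurable_funB. Qed.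

Lemma integrable_put m k : cs_finite_fm m ->
  m.-integrable setT (EFin \o (fun x : R => Num.max (k - x) 0)).
Proof.
move=> fm; apply: le_integrable (finite_fm_affine (-1) k fm) => //.
  by apply/measurable_EFinP; exact: measurable_put.
move=> x _ /=; rewrite lee_fin.
have -> : -1 * x + k = k - x by ring.
by case: (ltP (k - x) 0) => h; rewrite ?normr0.
Qed.

Lemma integrable_call m k : cs_finite_fm m ->
  m.-integrable setT (EFin \o (fun x : R => Num.max (x - k) 0)).
Proof.
move=> fm; apply: le_integrable (finite_fm_affine 1 (- k) fm) => //.
  by apply/measurable_EFinP; exact: measurable_call.
move=> x _ /=; rewrite lee_fin mul1r.
by case: (ltP (x - k) 0) => h; rewrite ?normr0.
Qed.

Lemma Rintegral_affine m p q : cs_finite_fm m ->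
  \int[m]_x (p * x + q) = p * cs_mean m + q * cs_mass m.
Proof.
move=> fm; have m1 := finite_fm_affine 1 0 fm.
have mx : m.-integrable setT (EFin \o (fun x : R => x)) by case: fm.
rewrite RintegralD//; last 2 first.
- by have := finite_fm_affine p 0 fm; under [X in _.-integrable _ X]eq_fun do rewrite /= addr0.
- by have := finite_fm_affine 0 q fm; under [X in _.-integrable _ X]eq_fun do rewrite /= mul0r add0r.
by rewrite RintegralZl// Rintegral_cst.
Qed.

(** Integrate the pointwise identity (k - x)^+ = (x - k)^+ + (k - x). *)
Lemma put_call_parity m k : cs_finite_fm m ->
  cs_Pfun m k = cs_Cfun m k + (cs_mass m * k - cs_mean m).
Proof.
move=> fm; have -> : cs_mass m * k - cs_mean m = \int[m]_x (-1 * x + k).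
  by rewrite Rintegral_affine//; ring.
have -> : cs_Cfun m k = \int[m]_x Num.max (x - k) 0 by [].
rewrite -RintegralD//; [|exact: integrable_call|exact: finite_fm_affine].
apply: eq_Rintegral => x _.
by case: (ltP (k - x) 0); case: (ltP (x - k) 0); lra.
Qed.

Lemma convex_fun_Pfun m : cs_finite_fm m -> cs_convex_fun (cs_Pfun m).
Proof.
move=> fm k l t t0 t1.
have ik := integrable_put k fm; have il := integrable_put l fm.
have ikl := integrable_put (t * k + (1 - t) * l) fm.
have -> : t * cs_Pfun m k + (1 - t) * cs_Pfun m l =
    \int[m]_x (t * Num.max (k - x) 0 + (1 - t) * Num.max (l - x) 0).
  by rewrite RintegralD// ?RintegralZl//; exact: integrable_RZl.
apply: le_Rintegral => //.
  by apply: integrable_RD => //; exact: integrable_RZl.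
move=> x _; rewrite ge_max; apply/andP; split.
  have h1 : k - x <= Num.max (k - x) 0 by rewrite le_max lexx.
  have h2 : l - x <= Num.max (l - x) 0 by rewrite le_max lexx.
  by have t2 : 0 <= 1 - t by [lra]; nra.
by rewrite addr_ge0// mulr_ge0// ?le_max ?lexx ?orbT//; lra.
Qed.

(** For fixed [x] the put payoff is nondecreasing and 1-Lipschitz in the strike; integrating the
    constant [l - k] produces the factor [cs_mass m]. *)
Lemma Pfun_lipschitz m k l : cs_finite_fm m -> k <= l ->
  cs_Pfun m k <= cs_Pfun m l <= cs_Pfun m k + cs_mass m * (l - k).
Proof.
move=> fm kl; have ik := integrable_put k fm.
have il := integrable_put l fm.
have ic : m.-integrable setT (EFin \o (fun x : R => 0 * x + (l - k))).
  exact: finite_fm_affine.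
apply/andP; split.
  by apply: le_Rintegral => // x _; case: (ltP (k - x) 0); case: (ltP (l - x) 0); lra.
have -> : cs_mass m * (l - k) = \int[m]_x (0 * x + (l - k)).
  by rewrite Rintegral_affine//; ring.
rewrite [X in _ <= X + _](_ : _ = \int[m]_x Num.max (k - x) 0)// -RintegralD//.
apply: le_Rintegral => //; first exact: integrable_RD.
by move=> x _; case: (ltP (k - x) 0); case: (ltP (l - x) 0); lra.
Qed.

Lemma continuous_Pfun m : cs_finite_fm m -> continuous (cs_Pfun m).
Proof.
move=> fm k; apply/cvgrPdist_le => e e0.
have M0 : 0 <= cs_mass m by rewrite fine_ge0.
near=> l.
(* The [+ 1] keeps the radius positive when [m] has mass zero. *)
have kl : `|k - l| <= e / (cs_mass m + 1).
  near: l; apply: (@cvgr_dist_le _ _ _ _ _ id k) => //.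
  by rewrite divr_gt0//; lra.
have kl' : cs_mass m * `|k - l| <= e.
  apply: le_trans (_ : (cs_mass m + 1) * `|k - l| <= _).
    by rewrite ler_wpM2r//; lra.
  by rewrite mulrC -ler_pdivlMr//; lra.
have [h|h] := leP k l.
- have /andP[h1 h2] := Pfun_lipschitz fm h.
  by move: kl'; rewrite !ler0_norm; nra.
- have /andP[h1 h2] := Pfun_lipschitz fm (ltW h).
  by move: kl'; rewrite !ger0_norm; nra.
Unshelve. all: by end_near. Qed.

Lemma Pfun_ge0 m k : 0 <= cs_Pfun m k.
Proof. by apply: Rintegral_ge0 => x _; rewrite le_max lexx orbT. Qed.

Lemma Cfun_ge0 m k : 0 <= cs_Cfun m k.
Proof. by apply: Rintegral_ge0 => x _; rewrite le_max lexx orbT. Qed.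

Lemma continuous_Cfun m : cs_finite_fm m -> continuous (cs_Cfun m).
Proof.
move=> fm.
have -> : cs_Cfun m = fun k => cs_Pfun m k - (cs_mass m * k - cs_mean m).
  by apply/funext => k; rewrite put_call_parity//; ring.
move=> k; apply: cvgB; first exact: continuous_Pfun.
by apply: cvgB; [apply: cvgMl_tmp; exact: cvg_id|exact: cvg_cst].
Qed.

(** Dominated convergence: for fixed [x] the payoff at strike [- n] is zero as soon as [n] exceeds
    [|x|], and it is always at most [|x|]. *)
Lemma Pfun_cvg0 m : cs_finite_fm m -> cs_Pfun m (- n%:R) @[n --> \oo] --> 0.
Proof.
move=> fm.
pose f (n : nat) x : \bar R := (Num.max (- n%:R - x) 0)%:E.
have H1 (n : nat) : measurable_fun setT (f n) by apply/measurable_EFinP; exact: measurable_put.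
have H2 x : [set: R] x -> f n x @[n --> \oo] --> cst 0%E x.
  move=> _; apply: cvg_near_cst; near=> n.
  have : `|x| <= n%:R by near: n; exact: nbhs_infty_ger.
  rewrite ler_norml => /andP[h1 h2].
  by congr EFin; apply/max_idPr; lra.
have H3 x : [set: R] x -> `|x%:E|%E \is a fin_num by [].
have H4 : m.-integrable setT (fun x => `|x%:E|%E).
  by case: fm => _ /integrable_abse; apply.
have H5 (n : nat) x : [set: R] x -> (`|f n x| <= `|x%:E|)%E.
  move=> _; rewrite /f /= lee_fin.
  have := ler_norm (- x); rewrite normrN => h.
  have n0 : 0 <= n%:R :> R by [].
  case: (ltP (- n%:R - x) 0) => h'; rewrite ?normr0// ger0_norm//; lra.
have h := dominated_cvg measurableT H1 H2 H3 H4 H5.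
rewrite integral0 in h.
exact: fine_cvg h.
Unshelve. all: by end_near. Qed.

Lemma Cfun_cvg0 m : cs_finite_fm m -> cs_Cfun m n%:R @[n --> \oo] --> 0.
Proof.
move=> fm.
pose f (n : nat) x : \bar R := (Num.max (x - n%:R) 0)%:E.
have H1 (n : nat) : measurable_fun setT (f n) by apply/measurable_EFinP; exact: measurable_call.
have H2 x : [set: R] x -> f n x @[n --> \oo] --> cst 0%E x.
  move=> _; apply: cvg_near_cst; near=> n.
  have : `|x| <= n%:R by near: n; exact: nbhs_infty_ger.
  rewrite ler_norml => /andP[h1 h2].
  by congr EFin; apply/max_idPr; lra.
have H3 x : [set: R] x -> `|x%:E|%E \is a fin_num by [].
have H4 : m.-integrable setT (fun x => `|x%:E|%E).
  by case: fm => _ /integrable_abse; apply.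
have H5 (n : nat) x : [set: R] x -> (`|f n x| <= `|x%:E|)%E.
  move=> _; rewrite /f /= lee_fin.
  have h := ler_norm x.
  have n0 : 0 <= n%:R :> R by [].
  case: (ltP (x - n%:R) 0) => h'; rewrite ?normr0// ger0_norm//; lra.
have h := dominated_cvg measurableT H1 H2 H3 H4 H5.
rewrite integral0 in h.
exact: fine_cvg h.
Unshelve. all: by end_near. Qed.

Lemma meas_le_integrable m n f : cs_meas_le m n ->
  n.-integrable setT f -> m.-integrable setT f.
Proof.
move=> mn /integrableP[mf intf]; apply/integrableP; split => //.
apply: le_lt_trans intf; apply: ge0_le_measure_integral => //.
exact: measurableT_comp.
Qed.

Lemma meas_le_finite_fm m n : cs_meas_le m n -> cs_finite_fm n -> cs_finite_fm m.
Proof.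
move=> mn [nfin nx]; split; last exact: meas_le_integrable nx.
by apply: le_lt_trans nfin; exact: mn.
Qed.

Lemma meas_le_Rintegral m n f : cs_meas_le m n ->
  n.-integrable setT (EFin \o f) -> (forall x, 0 <= f x) ->
  \int[m]_x f x <= \int[n]_x f x.
Proof.
move=> mn nf f0; have mf := meas_le_integrable mn nf.
rewrite fine_le//; [exact: integrable_fin_num|exact: integrable_fin_num|].
apply: (ge0_le_measure_integral mn) => //; exact: measurable_int nf.
Qed.

Lemma meas_le_Pfun m n k : cs_meas_le m n -> cs_finite_fm n ->
  cs_Pfun m k <= cs_Pfun n k.
Proof.
move=> mn fn; apply: meas_le_Rintegral => //; first exact: integrable_put.
by move=> x; rewrite le_max lexx orbT.
Qed.

Lemma meas_le_Cfun m n k : cs_meas_le m n -> cs_finite_fm n ->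
  cs_Cfun m k <= cs_Cfun n k.
Proof.
move=> mn fn; apply: meas_le_Rintegral => //; first exact: integrable_call.
by move=> x; rewrite le_max lexx orbT.
Qed.

Lemma cx_le_Rintegral m n f : cs_cx_le m n -> cs_convex_fun f ->
  m.-integrable setT (EFin \o f) -> n.-integrable setT (EFin \o f) ->
  \int[m]_x f x <= \int[n]_x f x.
Proof.
move=> mn cf mf nf.
by rewrite fine_le//; [exact: integrable_fin_num|exact: integrable_fin_num|exact: mn].
Qed.

(** An affine function and its negative are both convex, so the inequality holds in both
    directions. *)
Lemma cx_le_affine m n p q : cs_finite_fm m -> cs_finite_fm n -> cs_cx_le m n ->
  p * cs_mean m + q * cs_mass m = p * cs_mean n + q * cs_mass n.
Proof.
move=> fm fn mn; have h p' q' :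
    p' * cs_mean m + q' * cs_mass m <= p' * cs_mean n + q' * cs_mass n.
  rewrite -!Rintegral_affine//; apply: cx_le_Rintegral => //.
  - exact: convex_fun_affine.
  - exact: finite_fm_affine.
  - exact: finite_fm_affine.
by apply/eqP; rewrite eq_le h/=; have := h (- p) (- q); lra.
Qed.

Lemma cx_le_mass m n : cs_finite_fm m -> cs_finite_fm n -> cs_cx_le m n ->
  cs_mass m = cs_mass n.
Proof. by move=> fm fn /(cx_le_affine 0 1 fm fn); rewrite !mul0r !mul1r !add0r. Qed.

Lemma cx_le_mean m n : cs_finite_fm m -> cs_finite_fm n -> cs_cx_le m n ->
  cs_mean m = cs_mean n.
Proof. by move=> fm fn /(cx_le_affine 1 0 fm fn); rewrite !mul0r !mul1r !addr0. Qed.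

End first_moment.

(** * A sufficient condition for convex order: mass is moved from an interval to its outside *)

Section cut_criterion.
Variable R : realType.
Implicit Types (m n : {measure set R -> \bar R}) (D : set R) (f : R -> R) (a c x : R).

(** Replacing both measures by their restrictions to [D] turns the comparison on subsets of [D] into
    one on all measurable sets. *)
Lemma ge0_le_measure_integral_on m n D (F : R -> \bar R) : measurable D ->
  (forall E, measurable E -> E `<=` D -> (m E <= n E)%E) ->
  (forall x, 0 <= F x)%E -> measurable_fun setT F ->
  (\int[m]_(x in D) F x <= \int[n]_(x in D) F x)%E.
Proof.
move=> mD mn F0 mF.
rewrite (eq_measure_integral (mrestr m mD)); last first.
  by move=> A mA AD; rewrite /= /mrestr setIidl.
rewrite [leRHS](eq_measure_integral (mrestr n mD)); last first.
  by move=> A mA AD; rewrite /= /mrestr setIidl.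
apply: ge0_le_measure_integral => // E mE; apply: mn; last exact: subIsetr.
exact: measurableI.
Qed.

(** The minorant bounds the negative part of [f]. If the positive part had infinite integral,
    subtracting the finite integral of the negative part would leave the integral of [f]
    infinite. *)
Lemma integrable_of_minorant m f g : measurable_fun setT f ->
  m.-integrable setT (EFin \o g) -> (forall x, g x <= f x) ->
  (\int[m]_x (f x)%:E < +oo)%E -> m.-integrable setT (EFin \o f).
Proof.
move=> mf ig gf intf.
have mf' : measurable_fun setT (EFin \o f) by exact/measurable_EFinP.
have fneg : (\int[m]_x (EFin \o f)^\- x < +oo)%E.
  apply: le_lt_trans (integral_funeneg_lt_pinfty measurableT ig).
  apply: ge0_le_integral => //.
  - exact: measurable_funeneg.
  - by apply: measurable_funeneg; exact: measurable_int ig.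
  - by move=> x _; apply: (@funeneg_le _ _ setT); rewrite ?inE// => y _; rewrite lee_fin gf.
apply/integrableP; split => //.
rewrite -[X in integral _ _ X]/(abse \o (EFin \o f)) fune_abse.
rewrite ge0_integralD//; [|exact: measurable_funepos|exact: measurable_funeneg].
apply: lte_add_pinfty => //.
have : (\int[m]_x (EFin \o f)^\+ x - \int[m]_x (EFin \o f)^\- x < +oo)%E.
  by rewrite -integralE.
have : (0 <= \int[m]_x (EFin \o f)^\- x)%E by exact: integral_ge0.
move: fneg; set A := integral _ _ _; set B := integral _ _ _.
move=> A1 _; rewrite !ltey; apply: contra => /eqP ->.
by rewrite addye// -ltNye lteNr; exact: A1.
Qed.

Lemma convex_fun_subaffine f p q : cs_convex_fun f ->
  cs_convex_fun (fun x => f x - (p * x + q)).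
Proof. by move=> cf x y t t0 t1; have := cf x y t t0 t1; lra. Qed.

(* Compare a convex function with its chord over [a, c]: it is below the chord
   where [m] has more mass, and above it where [n] has more mass. *)
Lemma cx_le_cut m n a c : cs_finite_fm m -> cs_finite_fm n ->
  cs_mass m = cs_mass n -> cs_mean m = cs_mean n -> a < c ->
  (forall E, measurable E -> E `<=` `[a, c] -> (n E <= m E)%E) ->
  (forall E, measurable E -> E `<=` ~` `[a, c] -> (m E <= n E)%E) ->
  cs_cx_le m n.
Proof.
move=> fm fn mass mean ac nm mn f cf.
pose s := (f c - f a) / (c - a); pose q := f a - s * a.
have qE x : s * x + q = f a + s * (x - a) by rewrite /q; ring.
pose psi x := f x - (s * x + q).
have cpsi : cs_convex_fun psi by exact: convex_fun_subaffine.
have mpsi : measurable_fun setT (EFin \o psi).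
  by apply/measurable_EFinP; exact: measurable_convex_fun.
have psiD x : x \in `[a, c] -> psi x <= 0.
  rewrite in_itv/= => xac; rewrite subr_le0 qE; exact: convex_fun_chord.
have psiC x : x \notin `[a, c] -> 0 <= psi x.
  rewrite in_itv/= negb_and -!ltNge => /orP xac.
  rewrite subr_ge0 qE; apply: convex_fun_chord_le => //.
  by case: xac => /ltW; [left|right].
(* The signs of [psi] place its positive part outside [[a, c]], where [m] is below [n], and its
   negative part inside, where [n] is below [m]. *)
have posE (k : {measure set R -> \bar R}) :
    (\int[k]_x (EFin \o psi)^\+ x = \int[k]_(x in ~` `[a, c]) (EFin \o psi)^\+ x)%E.
  rewrite [RHS]integral_mkcond; apply: eq_integral => x _.
  rewrite patchE; case: ifPn => //; rewrite notin_setE/= => /contrapT/psiD h.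
  by rewrite funeposE; apply/max_idPr; rewrite lee_fin.
have negE (k : {measure set R -> \bar R}) :
    (\int[k]_x (EFin \o psi)^\- x = \int[k]_(x in `[a, c]) (EFin \o psi)^\- x)%E.
  rewrite [RHS]integral_mkcond; apply: eq_integral => x _.
  rewrite patchE; case: ifPn => //; rewrite notin_setE/= => /negP/psiC h.
  by rewrite funenegE; apply/max_idPr; rewrite -EFinN lee_fin oppr_le0.
have psi_mn : (\int[m]_x (psi x)%:E <= \int[n]_x (psi x)%:E)%E.
  rewrite integralE [leRHS]integralE; apply: leeB.
  - rewrite -/(EFin \o psi) !posE; apply: ge0_le_measure_integral_on => //.
      exact: measurableC.
    exact: measurable_funepos.
  - rewrite -/(EFin \o psi) !negE; apply: ge0_le_measure_integral_on => //.
    exact: measurable_funeneg.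
(* When [f] has infinite integral under [n] nothing is left to prove. Otherwise an affine minorant
   makes [f] integrable under [n], and the chord can be subtracted. *)
have [fn_lt|] := ltP (\int[n]_x (f x)%:E)%E +oo%E; last first.
  by rewrite leye_eq => /eqP ->; exact: leey.
have [p [r minor]] := convex_fun_affine_minorant cf.
have fni : n.-integrable setT (EFin \o f).
  apply: (integrable_of_minorant _ (finite_fm_affine p r fn)) => //.
  exact: measurable_convex_fun.
have ln := finite_fm_affine s q fn; have lm := finite_fm_affine s q fm.
have psin : n.-integrable setT (EFin \o psi) by exact: (integrableB measurableT fni ln).
have psim : m.-integrable setT (EFin \o psi).
  have [p' [r' minor']] := convex_fun_affine_minorant cpsi.
  apply: (integrable_of_minorant _ (finite_fm_affine p' r' fm)) => //.
    exact: measurable_convex_fun.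
  by apply: le_lt_trans psi_mn _; exact: integrable_lty.
have fE (k : {measure set R -> \bar R}) : k.-integrable setT (EFin \o psi) -> cs_finite_fm k ->
    (\int[k]_x (f x)%:E = \int[k]_x (psi x)%:E + (s * cs_mean k + q * cs_mass k)%:E)%E.
  move=> ipsi fk; have lk := finite_fm_affine s q fk.
  rewrite -Rintegral_affine// fineK; last exact: integrable_fin_num.
  rewrite -integralD//; apply: eq_integral => x _ /=.
  by rewrite -EFinD /psi subrK.
(* Equal mass and mean give the chord the same integral under [m] and [n], so the comparison passes
   from [psi] to [f]. *)
by rewrite !fE// mass mean leeD2r.
Qed.

End cut_criterion.

(** * Integrals against scaled restrictions of a measure *)

Section restricted_measures.
Variable R : realType.
Implicit Types (m : {measure set R -> \bar R}) (D E : set R) (f : R -> R).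

(** Split the line into [D] and its complement: the restriction agrees with [m] on subsets of [D],
    and the complement is null for it. *)
Lemma integral_mrestr m D (mD : measurable D) (F : R -> \bar R) :
  measurable_fun setT F ->
  (\int[mrestr m mD]_x F x = \int[m]_(x in D) F x)%E.
Proof.
move=> mF; have mDc := measurableC mD.
rewrite -[X in integral _ X _](setUv D) integral_setU//; last 2 first.
- by rewrite setUv.
- by rewrite disj_set2E setICr.
rewrite [X in (_ + X)%E](_ : _ = 0%E) ?adde0.
  by apply: eq_measure_integral => A mA AD; rewrite /= /mrestr setIidl.
apply: null_set_integral => //; first exact: measurable_funTS.
by rewrite /= /mrestr setICl measure0.
Qed.

(** Positive and negative parts are scaled and restricted separately; integrability on [D] lets the
    factor distribute over their difference. *)
Lemma integral_mscale_mrestr m D (mD : measurable D) (k : {nonneg R}) f :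
  m.-integrable setT (EFin \o f) ->
  (\int[mscale k (mrestr m mD)]_x (f x)%:E = (k%:num * \int[m]_(x in D) f x)%:E)%E.
Proof.
move=> mf; have mF := measurable_int _ mf.
have mfD : m.-integrable D (EFin \o f) by apply: integrableS mf.
rewrite EFinM fineK; last exact: integrable_fin_num.
rewrite [LHS]integralE.
have -> : (\int[m]_(x in D) (f x)%:E = \int[m]_(x in D) (EFin \o f)^\+ x -
    \int[m]_(x in D) (EFin \o f)^\- x)%E by rewrite -integralE.
rewrite muleBr//; last exact: (integrable_add_def mD mfD).
have mp : measurable_fun setT ((EFin \o f)^\+)%E by exact: measurable_funepos.
have mn : measurable_fun setT ((EFin \o f)^\-)%E by exact: measurable_funeneg.
by rewrite !ge0_integral_mscale// !integral_mrestr.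
Qed.

End restricted_measures.

(** * Spreading mass of [T] from [[a, c]] to both sides while staying below [nu] *)

Section spreading.
Variable R : realType.

(** Here [sA], [xA] and [sC], [xC] stand for the mass and first moment of [nu - T] to the left of
    [a] and to the right of [c], and [t], [t1] for those of [T] on [[a, c]]. The two equations
    express that mass and mean are kept. The weight [al] is strictly positive because it will
    multiply the gain at strike [a]. *)
Lemma spreading_weights (sA sC xA xC t t1 a c : R) :
  0 <= sA -> 0 <= sC -> 0 < t -> a * t <= t1 -> t1 <= c * t ->
  0 < a * sA - xA -> 0 < xC - c * sC ->
  exists al be ga : R, [/\ 0 < al <= 1, 0 <= be <= 1, 0 <= ga <= 1,
    al * sA + ga * sC = be * t & al * xA + ga * xC = be * t1].
Proof.
move=> sA0 sC0 t0 at1 t1c xA0 xC0.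
(* [b] is the barycentre of [T] on [[a, c]], and [X], [Y] are, up to sign, the moments about [b] of
   the room on the left and on the right. Weight [Y] on the left and [X] on the right balance about
   [b], [w] then matches the mass, and division by [d] makes every weight at most 1. *)
pose b := t1 / t.
have bt : b * t = t1 by rewrite /b divfK//; lra.
have ab : a <= b by rewrite /b ler_pdivlMr.
have bc : b <= c by rewrite /b ler_pdivrMr.
pose X := b * sA - xA; pose Y := xC - b * sC.
have X0 : 0 < X by rewrite /X; nra.
have Y0 : 0 < Y by rewrite /Y; nra.
pose w := (Y * sA + X * sC) / t.
have wt : w * t = Y * sA + X * sC by rewrite /w divfK//; lra.
have w0 : 0 <= w by rewrite /w divr_ge0//; [nra|exact: ltW].
pose d := 1 + X + Y + w.
have d0 : 0 < d by rewrite /d; lra.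
have le1 z : z <= d -> z / d <= 1 by rewrite ler_pdivrMr// mul1r.
exists (Y / d), (w / d), (X / d); split.
- by rewrite divr_gt0//=; apply: le1; rewrite /d; lra.
- by rewrite divr_ge0 ?(ltW d0)//=; apply: le1; rewrite /d; lra.
- by rewrite divr_ge0 ?(ltW d0) ?(ltW X0)//=; apply: le1; rewrite /d; lra.
- by rewrite -[RHS]mulrAC wt; field; lra.
- have -> : w / d * t1 = b * (w * t) / d by rewrite -bt; field; lra.
  by rewrite wt /X /Y; field; lra.
Qed.

Variables (T nu : {measure set R -> \bar R}) (a c : R).
Hypotheses (fnu : cs_finite_fm nu) (Tnu : cs_meas_le T nu) (ac : a < c).

Let A : set R := [set` `]-oo, a[ ].
Let B : set R := [set` `[a, c] ].
Let C : set R := [set` `]c, +oo[ ].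
Let mA : measurable A. Proof. exact: measurable_itv. Qed.
Let mB : measurable B. Proof. exact: measurable_itv. Qed.
Let mC : measurable C. Proof. exact: measurable_itv. Qed.

Let AB0 : A `&` B = set0.
Proof.
apply/seteqP; split => // x [].
rewrite /A /B /= !in_itv/= => xa /andP[ax _].
by exfalso; lra.
Qed.

Let AC0 : A `&` C = set0.
Proof.
apply/seteqP; split => // x [].
rewrite /A /C /= !in_itv/= andbT => xa cx.
by have := lt_trans (lt_trans cx xa) ac; rewrite ltxx.
Qed.

Let BC0 : B `&` C = set0.
Proof.
apply/seteqP; split => // x [].
rewrite /B /C /= !in_itv/= andbT => /andP[_ xc] cx.
by exfalso; lra.
Qed.

Let ABC : setT = A `|` (B `|` C).
Proof.
apply/seteqP; split => // x _; rewrite /A /B /C /= !in_itv/= andbT.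
case: (ltP x a) => xa; first by left.
by right; case: (leP x c) => xc; [left|right].
Qed.

Let A_BC0 : A `&` (B `|` C) = set0.
Proof. by rewrite setIUr AB0 AC0 setU0. Qed.

Lemma Rintegral_split (m : {measure set R -> \bar R}) (f : R -> R) :
  m.-integrable setT (EFin \o f) ->
  \int[m]_x f x = \int[m]_(x in A) f x + \int[m]_(x in B) f x + \int[m]_(x in C) f x.
Proof.
move=> mf; have mBC : measurable (B `|` C) by exact: measurableU.
rewrite -addrA ABC Rintegral_setU//; last 2 first.
- by rewrite -ABC.
- by rewrite disj_set2E A_BC0.
congr +%R; rewrite Rintegral_setU//; last by rewrite disj_set2E BC0.
exact: integrableS mf.
Qed.

Let measure_split (m : {measure set R -> \bar R}) E : measurable E ->
  m E = (m (E `&` A) + m (E `&` B) + m (E `&` C))%E.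
Proof.
move=> mE; rewrite -addeA -measureU; [|exact: measurableI|exact: measurableI|].
- rewrite -setIUr -measureU; first by rewrite -setIUr -ABC setIT.
  + exact: measurableI.
  + by apply: measurableI => //; exact: measurableU.
  + by rewrite setIACA A_BC0 setI0.
- by rewrite setIACA BC0 setI0.
Qed.

Variables al be ga : {nonneg R}.
Hypotheses (al1 : al%:num <= 1) (be1 : be%:num <= 1) (ga1 : ga%:num <= 1).

(** Complementary weights: on [A] and [C] the new measure is a mixture of [T] and [nu], on [B] it
    keeps the share [1 - be] of [T]. *)
Let al' : {nonneg R} := NngNum (eqbRL (subr_ge0 _ _) al1).
Let be' : {nonneg R} := NngNum (eqbRL (subr_ge0 _ _) be1).
Let ga' : {nonneg R} := NngNum (eqbRL (subr_ge0 _ _) ga1).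

(* This is [T + al (nu - T)|A - be T|B + ga (nu - T)|C], written without
   subtracting measures. *)
Definition spread_measure : {measure set R -> \bar R} :=
  measure_add
    (measure_add
       (measure_add (mscale al' (mrestr T mA)) (mscale al (mrestr nu mA)))
       (mscale be' (mrestr T mB)))
    (measure_add (mscale ga' (mrestr T mC)) (mscale ga (mrestr nu mC))).

Let nng0 (x : {nonneg R}) : 0 <= x%:num. Proof. by []. Qed.

Let addmE (m1 m2 : {measure set R -> \bar R}) E :
  (measure_add m1 m2 : {measure set R -> \bar R}) E = (m1 E + m2 E)%E.
Proof. exact: measure_addE. Qed.

Let mix_le (x r s : R) : 0 <= x -> x <= 1 -> 0 <= r <= s ->
  r <= (1 - x) * r + x * s <= s.
Proof. by move=> x0 x1 /andP[r0 rs]; apply/andP; split; nra. Qed.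

Let scale_le (x r s : R) : 0 <= x -> x <= 1 -> 0 <= r <= s -> 0 <= (1 - x) * r <= r.
Proof. by move=> x0 x1 /andP[r0 rs]; apply/andP; split; nra. Qed.

Let fin_meas E : measurable E ->
  exists r s : R, [/\ T E = r%:E, nu E = s%:E & 0 <= r <= s].
Proof.
move=> mE; have Enu := Tnu mE.
have nuE : (nu E < +oo)%E.
  by apply: le_lt_trans fnu.1; apply: le_measure; rewrite ?inE.
have TE := le_lt_trans Enu nuE.
exists (fine (T E)), (fine (nu E)).
have nuf : nu E \is a fin_num by rewrite ge0_fin_numE.
have Tf : T E \is a fin_num by rewrite ge0_fin_numE.
by rewrite !fineK// fine_ge0//= fine_le.
Qed.

(** Reduces the comparisons of measures that follow to real arithmetic in the values of [T] and [nu]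
    on the three pieces of [E]. *)
Lemma spread_measureE E : measurable E -> exists r1 s1 r2 s2 r3 s3 : R,
  [/\ [/\ T (E `&` A) = r1%:E, nu (E `&` A) = s1%:E, T (E `&` B) = r2%:E,
        nu (E `&` B) = s2%:E & T (E `&` C) = r3%:E /\ nu (E `&` C) = s3%:E],
    [/\ 0 <= r1 <= s1, 0 <= r2 <= s2 & 0 <= r3 <= s3],
    T E = (r1 + r2 + r3)%:E, nu E = (s1 + s2 + s3)%:E &
    spread_measure E = (((1 - al%:num) * r1 + al%:num * s1 + (1 - be%:num) * r2) +
      ((1 - ga%:num) * r3 + ga%:num * s3))%:E].
Proof.
move=> mE.
have [r1 [s1 [T1 n1 h1]]] := fin_meas (measurableI _ _ mE mA).
have [r2 [s2 [T2 n2 h2]]] := fin_meas (measurableI _ _ mE mB).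
have [r3 [s3 [T3 n3 h3]]] := fin_meas (measurableI _ _ mE mC).
exists r1, s1, r2, s2, r3, s3; split => //.
- by rewrite measure_split// T1 T2 T3.
- by rewrite measure_split// n1 n2 n3.
- have scE (k : {nonneg R}) (m : {measure set R -> \bar R}) D (mD : measurable D) r :
      m (E `&` D) = r%:E ->
      (mscale k (mrestr m mD) : {measure set R -> \bar R}) E = (k%:num * r)%:E.
    by move=> h; rewrite EFinM -h.
  by rewrite /spread_measure !addmE (scE _ _ _ _ _ T1) (scE _ _ _ _ _ n1) (scE _ _ _ _ _ T2)
    (scE _ _ _ _ _ T3) (scE _ _ _ _ _ n3).
Qed.

Lemma spread_measure_le : cs_meas_le spread_measure nu.
Proof.
move=> E mE; have [r1 [s1 [r2 [s2 [r3 [s3 [_ [h1 h2 h3] _ -> ->]]]]]]] := spread_measureE mE.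
have /andP[_ m1] := mix_le (nng0 al) al1 h1.
have /andP[_ m2] := scale_le (nng0 be) be1 h2.
have /andP[_ m3] := mix_le (nng0 ga) ga1 h3.
by case/andP: h2 => _ h2; rewrite lee_fin; lra.
Qed.

(** Together with [spread_measure_ge_out] this supplies the hypotheses of [cx_le_cut]: inside
    [[a, c]] the measure [T] is only scaled down, outside it is only raised towards [nu]. *)
Lemma spread_measure_le_in E : measurable E -> E `<=` B -> (spread_measure E <= T E)%E.
Proof.
move=> mE EB.
have [r1 [s1 [r2 [s2 [r3 [s3 [[T1 n1 _ _ [T3 n3]] [h1 h2 h3] -> _ ->]]]]]]] := spread_measureE mE.
have EA : E `&` A = set0.
  by apply/seteqP; split => // x [/EB Bx Ax]; rewrite -AB0; split.
have EC : E `&` C = set0.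
  by apply/seteqP; split => // x [/EB Bx Ax]; rewrite -BC0; split.
move: T1 n1 T3 n3; rewrite EA EC !measure0 => -[?] [?] [?] [?]; subst.
have /andP[_ m2] := scale_le (nng0 be) be1 h2.
by rewrite lee_fin; lra.
Qed.

Lemma spread_measure_ge_out E : measurable E -> E `<=` ~` B -> (T E <= spread_measure E)%E.
Proof.
move=> mE EB.
have [r1 [s1 [r2 [s2 [r3 [s3 [[_ _ T2 n2 _] [h1 h2 h3] -> _ ->]]]]]]] := spread_measureE mE.
have EB0 : E `&` B = set0 by apply/seteqP; split => // x [/EB].
move: T2 n2; rewrite EB0 !measure0 => -[?] [?]; subst.
have /andP[m1 _] := mix_le (nng0 al) al1 h1.
have /andP[m3 _] := mix_le (nng0 ga) ga1 h3.
by rewrite lee_fin; lra.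
Qed.

Lemma Rintegral_spread (f : R -> R) : nu.-integrable setT (EFin \o f) ->
  \int[spread_measure]_x f x = \int[T]_x f x +
    (al%:num * (\int[nu]_(x in A) f x - \int[T]_(x in A) f x)
     - be%:num * \int[T]_(x in B) f x
     + ga%:num * (\int[nu]_(x in C) f x - \int[T]_(x in C) f x)).
Proof.
move=> nf; have Tf := meas_le_integrable Tnu nf.
have sf := meas_le_integrable spread_measure_le nf.
(* Each summand is dominated by the sum, so integrability against the whole measure passes down to
   every term. *)
have sum2 (m1 m2 : {measure set R -> \bar R}) :
    (measure_add m1 m2).-integrable setT (EFin \o f) ->
    [/\ m1.-integrable setT (EFin \o f), m2.-integrable setT (EFin \o f) &
    (\int[measure_add m1 m2]_x (f x)%:E = \int[m1]_x (f x)%:E + \int[m2]_x (f x)%:E)%E].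
  move=> mf.
  have m1f : m1.-integrable setT (EFin \o f).
    by apply: meas_le_integrable mf => E mE; rewrite addmE leeDl.
  have m2f : m2.-integrable setT (EFin \o f).
    by apply: meas_le_integrable mf => E mE; rewrite addmE leeDr.
  by split => //; exact: integral_measure_add.
rewrite [LHS]/Rintegral /spread_measure.
have [s1 s2 ->] := sum2 _ _ sf.
have [s3 s4 ->] := sum2 _ _ s1.
have [s5 s6 ->] := sum2 _ _ s3.
have [s7 s8 ->] := sum2 _ _ s2.
rewrite !integral_mscale_mrestr// -!EFinD (Rintegral_split Tf) /=.
by ring.
Qed.

End spreading.

(** * A strict improvement of [T] in convex order *)

Section improvement.
Variable R : realType.
Implicit Types (m T nu : {measure set R -> \bar R}) (D : set R) (a c p q : R).

Lemma Rintegral_affine_on m D p q : cs_finite_fm m -> measurable D ->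
  \int[m]_(x in D) (p * x + q) = p * \int[m]_(x in D) x + q * fine (m D).
Proof.
move=> fm mD.
have aff p' q' : m.-integrable D (EFin \o (fun x : R => p' * x + q')).
  by apply: integrableS (finite_fm_affine p' q' fm).
have ix : m.-integrable D (EFin \o (fun x : R => x)).
  by case: fm => _; exact: integrableS.
have i0 : m.-integrable D (EFin \o (fun x : R => q)).
  have := aff 0 q; congr (_.-integrable _ _).
  by apply/funext => x /=; rewrite mul0r add0r.
rewrite RintegralD//; last exact: integrable_RZl.
by rewrite RintegralZl// Rintegral_cst.
Qed.

(** The payoff vanishes from [a] on and is affine before. In terms of mass and first moment on
    []-oo, a[], the gap between the puts of [nu] and [T] at [a] becomes the quantity [a * sA - xA]
    of [spreading_weights]. *)
Lemma Pfun_on m a : cs_finite_fm m ->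
  cs_Pfun m a = a * fine (m `]-oo, a[%classic) - \int[m]_(x in `]-oo, a[) x.
Proof.
move=> fm; transitivity (\int[m]_(x in `]-oo, a[) (-1 * x + a)).
  rewrite Rintegral_mkcond; apply: eq_Rintegral => x _.
  rewrite patchE; case: ifPn => [|/negP]; rewrite inE/= in_itv/= => xa.
    by rewrite (max_idPl _); lra.
  by rewrite (max_idPr _)// subr_le0 leNgt; exact/negP.
by rewrite Rintegral_affine_on//; ring.
Qed.

Lemma Cfun_on m c : cs_finite_fm m ->
  cs_Cfun m c = \int[m]_(x in `]c, +oo[) x - c * fine (m `]c, +oo[%classic).
Proof.
move=> fm; transitivity (\int[m]_(x in `]c, +oo[) (1 * x + - c)).
  rewrite Rintegral_mkcond; apply: eq_Rintegral => x _.
  rewrite patchE; case: ifPn => [|/negP]; rewrite inE/= in_itv/= andbT => xa.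
    by rewrite (max_idPl _); lra.
  by rewrite (max_idPr _)// subr_le0 leNgt; exact/negP.
by rewrite Rintegral_affine_on//; ring.
Qed.

Lemma fine_meas_le T nu D : cs_finite_fm nu -> cs_meas_le T nu -> measurable D ->
  fine (T D) <= fine (nu D).
Proof.
move=> fnu Tnu mD.
have fin m : cs_finite_fm m -> m D \is a fin_num.
  move=> [mfin _]; rewrite ge0_fin_numE//; apply: le_lt_trans mfin.
  by apply: le_measure; rewrite ?inE.
by apply: fine_le; [exact/fin/(meas_le_finite_fm Tnu)|exact: fin|exact: Tnu].
Qed.

(* Moving a little of the mass of [T] from [a, c] to both sides, where [nu - T]
   leaves room, raises [T] in convex order. *)
Lemma cx_improvement T nu a c : cs_finite_fm nu -> cs_meas_le T nu -> a < c ->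
  cs_Pfun T a < cs_Pfun nu a -> cs_Cfun T c < cs_Cfun nu c ->
  (0 < T `[a, c]%classic)%E ->
  exists eta : {measure set R -> \bar R},
    [/\ cs_cx_le T eta, cs_meas_le eta nu & cs_Pfun T a < cs_Pfun eta a].
Proof.
move=> fnu Tnu ac PTa CTc TB.
have fT := meas_le_finite_fm Tnu fnu.
have mB : measurable [set` `[a, c] ] by exact: measurable_itv.
have mA : measurable [set` `]-oo, a[ ] by exact: measurable_itv.
have mC : measurable [set` `]c, +oo[ ] by exact: measurable_itv.
have sA := fine_meas_le fnu Tnu mA; have sC := fine_meas_le fnu Tnu mC.
have TBfin : T `[a, c]%classic \is a fin_num.
  rewrite ge0_fin_numE//; apply: le_lt_trans fT.1.
  by apply: le_measure; rewrite ?inE.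
pose t := fine (T `[a, c]%classic); pose t1 := \int[T]_(x in `[a, c]) x.
have t0 : 0 < t by rewrite fine_gt0// TB/= -ge0_fin_numE.
(* Integrating affine functions that are nonnegative on [[a, c]] places the barycentre [t1 / t]
   between [a] and [c]. *)
have bnd p q : (forall x, x \in `[a, c] -> 0 <= p * x + q) -> 0 <= p * t1 + q * t.
  move=> h; rewrite -Rintegral_affine_on//; apply: Rintegral_ge0 => x; exact: h.
have at1 : a * t <= t1.
  have := bnd 1 (- a) _; rewrite mul1r mulNr subr_ge0; apply => x.
  by rewrite in_itv/= => /andP[ax _]; lra.
have t1c : t1 <= c * t.
  have := bnd (-1) c _; rewrite mulN1r addrC subr_ge0; apply => x.
  by rewrite in_itv/= => /andP[_ xc]; lra.
have PA := PTa; rewrite !Pfun_on// in PA.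
have CA := CTc; rewrite !Cfun_on// in CA.
have [al [be [ga [/andP[al0 al1] /andP[be0 be1] /andP[ga0 ga1] mass mean]]]] :=
  @spreading_weights R (fine (nu `]-oo, a[%classic) - fine (T `]-oo, a[%classic))
    (fine (nu `]c, +oo[%classic) - fine (T `]c, +oo[%classic))
    (\int[nu]_(x in `]-oo, a[) x - \int[T]_(x in `]-oo, a[) x)
    (\int[nu]_(x in `]c, +oo[) x - \int[T]_(x in `]c, +oo[) x) t t1 a c
    ltac:(lra) ltac:(lra) t0 at1 t1c ltac:(lra) ltac:(lra).
pose al' := NngNum (ltW al0); pose be' := NngNum be0; pose ga' := NngNum ga0.
have al1' : al'%:num <= 1 by [].
have be1' : be'%:num <= 1 by [].
have ga1' : ga'%:num <= 1 by [].
pose eta := spread_measure T nu a c al1' be1' ga1'.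
have eta_nu : cs_meas_le eta nu by exact: spread_measure_le.
have feta := meas_le_finite_fm eta_nu fnu.
have aff p q : \int[eta]_x (p * x + q) = \int[T]_x (p * x + q).
  rewrite Rintegral_spread//; last exact: finite_fm_affine.
  rewrite !Rintegral_affine_on// -/t -/t1 /=.
  rewrite -[RHS]addr0; congr +%R.
  transitivity (p * (al * (\int[nu]_(x in `]-oo, a[) x - \int[T]_(x in `]-oo, a[) x) +
      ga * (\int[nu]_(x in `]c, +oo[) x - \int[T]_(x in `]c, +oo[) x) - be * t1) +
    q * (al * (fine (nu `]-oo, a[%classic) - fine (T `]-oo, a[%classic)) +
      ga * (fine (nu `]c, +oo[%classic) - fine (T `]c, +oo[%classic)) - be * t)); first by ring.
  by rewrite mass mean !subrr !mulr0 addr0.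
exists eta; split => //.
- apply: (@cx_le_cut _ _ _ a c) => //.
  + by have := aff 0 1; rewrite !Rintegral_affine// !mul0r !add0r !mul1r.
  + by have := aff 1 0; rewrite !Rintegral_affine// !mul0r !addr0 !mul1r.
  + by move=> E mE EB; exact: spread_measure_le_in.
  + by move=> E mE EB; exact: spread_measure_ge_out.
(* The payoff at strike [a] vanishes on [[a, c]] and beyond, so only the left piece contributes: the
   gain is [al] times the put gap at [a]. *)
- rewrite [X in _ < X](Rintegral_spread fnu Tnu ac al1' be1' ga1'); last first.
    exact: integrable_put.
  rewrite -[X in X < _]/(\int[T]_x Num.max (a - x) 0) ltrDl /=.
  have putA m : cs_finite_fm m ->
      \int[m]_(x in `]-oo, a[) Num.max (a - x) 0 = cs_Pfun m a.
    move=> fm; rewrite Rintegral_mkcond; apply: eq_Rintegral => x _.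
    rewrite patchE; case: ifPn => [//|/negP]; rewrite inE/= in_itv/= => xa.
    by rewrite (max_idPr _)// subr_le0 leNgt; exact/negP.
  have put0 m D : (forall x, D x -> a <= x) ->
      \int[m]_(x in D) Num.max (a - x) 0 = 0.
    move=> h; rewrite /Rintegral integral0_eq// => x /h ax.
    by congr EFin; apply/max_idPr; lra.
  rewrite !putA// !put0; last 3 first.
  + by move=> x /=; rewrite in_itv/= andbT => cx; lra.
  + by move=> x /=; rewrite in_itv/= andbT => cx; lra.
  + by move=> x /=; rewrite in_itv/= => /andP[].
  by rewrite subrr !mulr0 subr0 addr0 mulr_gt0// subr_gt0.
Qed.

End improvement.

(** * The put function of the counter-shadow is the convex hull *)

Section hull.
Variable R : realType.
Implicit Types (m mu nu T eta : {measure set R -> \bar R}) (a c k e y : R).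

Lemma cx_le_trans m mu nu : cs_cx_le m mu -> cs_cx_le mu nu -> cs_cx_le m nu.
Proof. by move=> h1 h2 f cf; apply: le_trans (h1 f cf) (h2 f cf). Qed.

(** If [T] charged [[a, c]], the improved measure would still dominate [mu] in convex order and stay
    below [nu]. Maximality, tested on the put payoff at [a], then contradicts the strict gain
    there. *)
Lemma counter_shadow_null mu nu T a c : cs_finite_fm nu ->
  cs_is_counter_shadow nu mu T -> a < c ->
  cs_Pfun T a < cs_Pfun nu a -> cs_Cfun T c < cs_Cfun nu c ->
  T `[a, c]%classic = 0%E.
Proof.
move=> fnu [muT [Tnu Tmax]] ac PTa CTc.
apply/eqP; rewrite eq_le measure_ge0 andbT leNgt; apply/negP => TB.
have [eta [Teta etanu]] := cx_improvement fnu Tnu ac PTa CTc TB.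
apply/negP; rewrite -leNgt.
apply: cx_le_Rintegral (convex_fun_put a) _ _.
- by apply: Tmax => //; exact: cx_le_trans muT Teta.
- exact/integrable_put/(meas_le_finite_fm etanu).
- exact/integrable_put/(meas_le_finite_fm Tnu).
Qed.

(** For [x] outside [[a, c]] the payoff is affine in the strike over [[a, c]], so the two integrands
    differ only on the null set [[a, c]]. *)
Lemma Pfun_affine_null m a c t : cs_finite_fm m -> a < c ->
  m `[a, c]%classic = 0%E -> 0 <= t -> t <= 1 ->
  cs_Pfun m (t * a + (1 - t) * c) = t * cs_Pfun m a + (1 - t) * cs_Pfun m c.
Proof.
move=> fm ac m0 t0 t1; set k := t * a + (1 - t) * c.
have ak : a <= k by rewrite /k; nra.
have kc : k <= c by rewrite /k; nra.
have ia := integrable_put a fm; have ic := integrable_put c fm.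
have ita : m.-integrable setT (EFin \o (fun x => t * Num.max (a - x) 0)).
  exact: integrable_RZl.
have itc : m.-integrable setT (EFin \o (fun x => (1 - t) * Num.max (c - x) 0)).
  exact: integrable_RZl.
have -> : t * cs_Pfun m a + (1 - t) * cs_Pfun m c =
    \int[m]_x (t * Num.max (a - x) 0 + (1 - t) * Num.max (c - x) 0).
  by rewrite RintegralD// !RintegralZl.
congr fine; apply: ae_eq_integral => //.
- by apply/measurable_EFinP; exact: measurable_put.
- by apply: measurable_int; exact: (integrable_RD measurableT ita itc).
- exists [set` `[a, c] ]; split => //.
  move=> x /= h; rewrite in_itv/=; apply: contra_notT h.
  rewrite negb_and -!ltNge => /orP h _; congr EFin.
  case: h => h.
  + rewrite !(max_idPl _); rewrite ?subr_ge0; [|lra|lra|lra].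
    by rewrite /k; ring.
  + by rewrite !(max_idPr _) ?mulr0 ?addr0// subr_le0; lra.
Qed.

(** The intermediate value theorem between [y] and [k] yields the value [v]. The bound [h k / 2]
    forces [h a < h k], which keeps [a] different from [k]. *)
Lemma continuous_small_value (h : R -> R) k y e : continuous h -> 0 < h k ->
  0 < e -> h y <= Num.min e (h k / 2) ->
  exists a, [/\ 0 < h a <= e, h a < h k & Num.min y k <= a <= Num.max y k].
Proof.
move=> ch hk e0 hy; set v := Num.min e (h k / 2) in hy *.
have v0 : 0 < v by rewrite lt_min e0 divr_gt0.
have vk : v < h k by rewrite gt_min; apply/orP; right; lra.
have ve : v <= e by rewrite ge_min lexx.
have cw a c : {within `[a, c], continuous h}.
  by apply: continuous_subspaceT.
case: (leP y k) => yk.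
- have [a aI aE] : exists2 a, a \in `[y, k] & h a = v.
    by apply: IVT => //; rewrite ge_min hy le_max (ltW vk) orbT.
  by exists a; rewrite aE v0 ve vk; split.
- have [a aI aE] : exists2 a, a \in `[k, y] & h a = v.
    by apply: IVT => //; [exact: ltW|rewrite ge_min hy le_max (ltW vk) orbT].
  by exists a; rewrite aE v0 ve vk; split.
Qed.

Lemma Pgap_small m nu k e : cs_finite_fm nu -> cs_meas_le m nu ->
  cs_Pfun m k < cs_Pfun nu k -> 0 < e ->
  exists2 a, a < k & cs_Pfun m a < cs_Pfun nu a <= cs_Pfun m a + e.
Proof.
move=> fnu mnu gap e0; have fm := meas_le_finite_fm mnu fnu.
pose h x := cs_Pfun nu x - cs_Pfun m x.
have ch : continuous h by move=> x; apply: cvgB; exact: continuous_Pfun.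
have hk : 0 < h k by rewrite subr_gt0.
pose v := Num.min e (h k / 2).
have v0 : 0 < v by rewrite lt_min e0 divr_gt0.
(* Far to the left the gap is small, since it is at most the put of [nu], which tends to 0. *)
have [n [nk nv]] : exists n : nat, - n%:R <= k /\ h (- n%:R) <= v.
  have /cvgrPdist_le /(_ _ v0) near_v := Pfun_cvg0 fnu.
  near \oo => n; exists n; split.
    by rewrite lerNl; near: n; exact: nbhs_infty_ger.
  have : `|0 - cs_Pfun nu (- n%:R)| <= v by near: n.
  rewrite sub0r normrN ger0_norm ?Pfun_ge0// /h => nu_v.
  by have := Pfun_ge0 m (- n%:R); lra.
have [a [/andP[ha he] hak]] := continuous_small_value ch hk e0 nv.
rewrite (min_idPl nk) (max_idPr nk) => /andP[_ ak].
exists a; last by rewrite -subr_gt0 ha/=; move: he; rewrite /h; lra.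
by rewrite lt_neqAle ak andbT; apply: contraTneq hak => ->; rewrite ltxx.
Unshelve. all: by end_near. Qed.

Lemma Cgap_small m nu k e : cs_finite_fm nu -> cs_meas_le m nu ->
  cs_Cfun m k < cs_Cfun nu k -> 0 < e ->
  exists2 c, k < c & cs_Cfun m c < cs_Cfun nu c <= cs_Cfun m c + e.
Proof.
move=> fnu mnu gap e0; have fm := meas_le_finite_fm mnu fnu.
pose h x := cs_Cfun nu x - cs_Cfun m x.
have ch : continuous h by move=> x; apply: cvgB; exact: continuous_Cfun.
have hk : 0 < h k by rewrite subr_gt0.
pose v := Num.min e (h k / 2).
have v0 : 0 < v by rewrite lt_min e0 divr_gt0.
have [n [nk nv]] : exists n : nat, k <= n%:R /\ h n%:R <= v.
  have /cvgrPdist_le /(_ _ v0) near_v := Cfun_cvg0 fnu.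
  near \oo => n; exists n; split.
    by near: n; exact: nbhs_infty_ger.
  have : `|0 - cs_Cfun nu n%:R| <= v by near: n.
  rewrite sub0r normrN ger0_norm ?Cfun_ge0// /h => nu_v.
  by have := Cfun_ge0 m n%:R; lra.
have [c [/andP[hc he] hck]] := continuous_small_value ch hk e0 nv.
rewrite (min_idPr nk) (max_idPl nk) => /andP[kc _].
exists c; last by rewrite -subr_gt0 hc/=; move: he; rewrite /h; lra.
by rewrite lt_neqAle kc andbT eq_sym; apply: contraTneq hck => ->; rewrite ltxx.
Unshelve. all: by end_near. Qed.

Lemma counter_shadow_hull mu nu T : cs_finite_fm mu -> cs_finite_fm nu ->
  cs_is_counter_shadow nu mu T -> cs_is_convex_hull (cs_Ptilde nu mu) (cs_Pfun T).
Proof.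
move=> fmu fnu shT; have [muT [Tnu _]] := shT.
have fT := meas_le_finite_fm Tnu fnu.
(* [T] inherits mass and mean from [mu] through the convex order, so its parity carries the same
   affine term as [cs_Ptilde]. *)
have parity k : cs_Pfun T k = cs_Cfun T k + (cs_mass mu * k - cs_mean mu).
  by rewrite put_call_parity// (cx_le_mass fmu fT muT) (cx_le_mean fmu fT muT).
split; first exact: convex_fun_Pfun.
split => [k|g cg gle k].
  by rewrite le_min meas_le_Pfun//= parity lerD2r meas_le_Cfun.
have gP x : g x <= cs_Pfun nu x by have := gle x; rewrite le_min => /andP[].
have gC x : g x <= cs_Cfun nu x + (cs_mass mu * x - cs_mean mu).
  by have := gle x; rewrite le_min => /andP[].
have [Pk|Pk] := leP (cs_Pfun nu k) (cs_Pfun T k); first exact: le_trans Pk.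
have [Ck|Ck] := leP (cs_Cfun nu k) (cs_Cfun T k).
  by apply: le_trans (gC k) _; rewrite parity lerD2r.
apply/ler_addgt0Pr => e e0.
have [a ak /andP[Pa Pae]] := Pgap_small fnu Tnu Pk e0.
have [c kc /andP[Cc Cce]] := Cgap_small fnu Tnu Ck e0.
have ac : a < c by exact: lt_trans kc.
have TB := counter_shadow_null fnu shT ac Pa Cc.
pose t := (c - k) / (c - a).
have t0 : 0 <= t by rewrite divr_ge0// subr_ge0 ltW.
have t1 : t <= 1 by rewrite ler_pdivrMr ?subr_gt0// mul1r; lra.
have kE : k = t * a + (1 - t) * c by rewrite /t; field; lra.
have := Pfun_affine_null fT ac TB t0 t1; rewrite -kE => ->.
rewrite {1}kE; apply: le_trans (cg a c t t0 t1) _.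
have ga : g a <= cs_Pfun T a + e by exact: le_trans (gP a) _.
(* Parity adds the same affine term to the calls of [nu] and [T], so the small call gap at [c]
   bounds [g c] against the put of [T]. *)
have gc : g c <= cs_Pfun T c + e by have := gC c; rewrite parity; lra.
have -> : t * cs_Pfun T a + (1 - t) * cs_Pfun T c + e =
  t * (cs_Pfun T a + e) + (1 - t) * (cs_Pfun T c + e) by ring.
by apply: lerD; apply: ler_wpM2l => //; lra.
Qed.

End hull.

(** * The second distributional derivative of the put function *)

Section second_derivative.
Variable R : realType.
Notation leb := (@lebesgue_measure R).

Lemma derive1_eq0_left (f : R -> R) a : (forall x, x < a -> f x = 0) ->
  forall x, x < a -> derive1 f x = 0.
Proof.
move=> f0 x xa; rewrite derive1E (@near_eq_derive _ _ _ f (cst 0)) ?derive_cst//.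
near=> z; apply: f0; near: z.
exact: lt_nbhsl.
Unshelve. all: by end_near. Qed.

Lemma derive1_eq0_right (f : R -> R) b : (forall x, b < x -> f x = 0) ->
  forall x, b < x -> derive1 f x = 0.
Proof.
move=> f0 x bx; rewrite derive1E (@near_eq_derive _ _ _ f (cst 0)) ?derive_cst//.
near=> z; apply: f0; near: z.
exact: lt_nbhsr.
Unshelve. all: by end_near. Qed.

Lemma derivable_continuous (f : R -> R) : (forall x, derivable f x 1) -> continuous f.
Proof. by move=> df x; exact/differentiable_continuous/derivable1_diffP/df. Qed.

Variable phi : R -> R.
Hypothesis tphi : cs_test_fun phi.
Let phi1 : R -> R := derive1 phi.
Let phi2 : R -> R := derive1 phi1.

Let dphi x : derivable phi x 1. Proof. exact: (tphi.1 0%N). Qed.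
Let dphi1 x : derivable phi1 x 1. Proof. exact: (tphi.1 1%N). Qed.
Let dphi2 x : derivable phi2 x 1. Proof. exact: (tphi.1 2%N). Qed.

Lemma test_fun_potential y :
  (\int[leb]_x (Num.max (x - y) 0 * phi2 x)%:E = (phi y)%:E)%E.
Proof.
have [_ [a [b supp]]] := tphi.
have phi0 x : b < x -> phi x = 0 by move=> bx; apply: supp; right.
have phi10 : forall x, b < x -> phi1 x = 0 by exact: derive1_eq0_right.
have phi20 : forall x, b < x -> phi2 x = 0 by exact: derive1_eq0_right phi10.
(* [N] lies strictly beyond [y] and the support of [phi]. The function [F] below is the
   antiderivative of [(x - y) * phi2 x] given by integration by parts, with [F N = 0] and
   [F y = - phi y]. *)
pose N := Num.max b y + 1.
have bN : b < N by rewrite /N ltr_pwDr// le_max lexx.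
have yN : y < N by rewrite /N ltr_pwDr// le_max lexx orbT.
pose F x := (x - y) * phi1 x - phi x.
have dF (x : R) : is_derive x 1 F ((x - y) * phi2 x).
  have d1 : is_derive x 1 phi (phi1 x).
    by rewrite /phi1 derive1E; apply/derivableP.
  have d2 : is_derive x 1 phi1 (phi2 x).
    by rewrite /phi2 derive1E; apply/derivableP.
  rewrite /F; apply: is_derive_eq.
  by rewrite /GRing.scale /=; ring.
have cF : continuous F.
  by apply: derivable_continuous => x; exact: (@ex_derive _ _ _ _ _ _ _ (dF x)).
have c2 : continuous (fun x => (x - y) * phi2 x).
  move=> x; apply: cvgM; last exact: derivable_continuous.
  by apply: cvgB; [exact: cvg_id|exact: cvg_cst].
transitivity (\int[leb]_(x in `[y, N]) ((x - y) * phi2 x)%:E)%E.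
  rewrite [RHS]integral_mkcond; apply: eq_integral => x _.
  rewrite patchE; case: ifPn => [|/negP]; rewrite inE/= in_itv/=.
    by move=> /andP[yx _]; rewrite (max_idPl _)// subr_ge0.
  move=> /negP; rewrite negb_and -!ltNge => /orP[xy|Nx].
    by rewrite (max_idPr _) ?mul0r// subr_le0 ltW.
  by rewrite phi20 ?mulr0//; exact: lt_trans Nx.
rewrite (@continuous_FTC2 _ _ F)//.
- by rewrite /F subrr mul0r phi0// phi10// mulr0 subr0 !sub0r -EFinB sub0r opprK.
- exact: continuous_subspaceT.
- split.
  + by move=> x _; exact: (@ex_derive _ _ _ _ _ _ _ (dF x)).
  + by apply: cvg_at_right_filter; exact: cF.
  + by apply: cvg_at_left_filter; exact: cF.
- by move=> x _; rewrite derive1E; exact: (@derive_val _ _ _ _ _ _ _ (dF x)).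
Qed.

Lemma finite_measure_second_derivative (T : {finite_measure set R -> \bar R}) :
  cs_finite_fm T ->
  (\int[T]_x (phi x)%:E = \int[leb]_x (cs_Pfun T x * phi2 x)%:E)%E.
Proof.
move=> fT; have [_ [a [b supp]]] := tphi.
have phi20r : forall x, b < x -> phi2 x = 0.
  by do 2 apply: derive1_eq0_right; move=> x bx; apply: supp; right.
have phi20l : forall x, x < a -> phi2 x = 0.
  by do 2 apply: derive1_eq0_left; move=> x xa; apply: supp; left.
have c2 : continuous phi2 by exact: derivable_continuous.
have m2 : measurable_fun setT phi2 by exact: continuous_measurable_fun.
(* The first coordinate is integrated against [T], the second against Lebesgue measure. One order of
   integration gives [phi] by [test_fun_potential], the other the put function times [phi2]. *)
pose G (z : R * R) : \bar R := (Num.max (z.2 - z.1) 0 * phi2 z.2)%:E.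
have mG : measurable_fun setT G.
  apply/measurable_EFinP; apply: measurable_funM.
    apply: measurable_maxr => //; apply: measurable_funB => //.
  exact: measurableT_comp.
have inner x : (\int[T]_y (Num.max (x - y) 0 * phi2 x)%:E = (cs_Pfun T x * phi2 x)%:E)%E.
  have ip := integrable_put x fT.
  rewrite EFinM fineK; last exact: integrable_fin_num ip.
  by rewrite -integralZr//; apply: eq_integral => y _; rewrite EFinM.
have innerabs x : (\int[T]_y `|(Num.max (x - y) 0 * phi2 x)%:E| =
    (cs_Pfun T x * `|phi2 x|)%:E)%E.
  have ip := integrable_put x fT.
  rewrite EFinM fineK; last exact: integrable_fin_num ip.
  rewrite -integralZr//; apply: eq_integral => y _.
  by rewrite -EFinM /= normrM ger0_norm// le_max lexx orbT.
(* Integrating the absolute value over [T] first leaves the put function times [|phi2|], which is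
   continuous and vanishes outside [[a, b]]. *)
have iG : (T \x leb)%E.-integrable setT G.
  apply/integrable21ltyP => //; rewrite /G /=.
  under eq_integral do rewrite innerabs.
  have -> : (\int[leb]_x (cs_Pfun T x * `|phi2 x|)%:E =
      \int[leb]_(x in `[a, b]) (cs_Pfun T x * `|phi2 x|)%:E)%E.
    rewrite [RHS]integral_mkcond; apply: eq_integral => x _.
    rewrite patchE; case: ifPn => [//|/negP]; rewrite inE/= in_itv/=.
    move=> /negP; rewrite negb_and -!ltNge => /orP[xa|bx].
      by rewrite phi20l// normr0 mulr0.
    by rewrite phi20r// normr0 mulr0.
  apply: integrable_lty => //; apply: continuous_compact_integrable.
    exact: segment_compact.
  apply: continuous_subspaceT => x; apply: cvgM; first exact: continuous_Pfun.
  by apply: cvg_norm; exact: c2.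
have := Fubini iG; rewrite /G /=.
under eq_integral do rewrite test_fun_potential.
by under [X in _ = X -> _]eq_integral do rewrite inner.
Qed.

End second_derivative.

Lemma Pfun_second_derivative (R : realType) (T : {measure set R -> \bar R}) (phi : R -> R) :
  cs_finite_fm T -> cs_test_fun phi ->
  (\int[T]_x (phi x)%:E =
   \int[lebesgue_measure]_x (cs_Pfun T x * derive1 (derive1 phi) x)%:E)%E.
Proof.
move=> fT tphi; have Too : (T setT < +oo)%E by case: fT.
(* Restriction to the whole line turns [T] into an instance of a finite measure with the same
   values, as the Fubini argument requires. *)
pose T' : {finite_measure set R -> \bar R} := mfrestr measurableT Too.
have TT' (A : set R) : measurable A -> A `<=` setT -> T A = T' A.
  by move=> mA _; rewrite /T' /= /mfrestr /mrestr setIT.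
have intE (f : R -> \bar R) : (\int[T]_x f x = \int[T']_x f x)%E.
  exact: eq_measure_integral.
have fT' : cs_finite_fm T'.
  by apply: meas_le_finite_fm fT => A mA; rewrite (TT' _ mA (@subsetT _ A)).
rewrite intE finite_measure_second_derivative//.
by apply: eq_integral => x _; rewrite /cs_Pfun intE.
Qed.

Theorem theorem3p4 (R : realType) (mu nu T : {measure set R -> \bar R}) :
  cs_finite_fm mu -> cs_finite_fm nu -> cs_E_le mu nu ->
  cs_is_counter_shadow nu mu T ->
  cs_is_convex_hull (cs_Ptilde nu mu) (cs_Pfun T) /\
  (forall phi : R -> R, cs_test_fun phi ->
     (\int[T]_x (phi x)%:E =
      \int[lebesgue_measure]_x (cs_Pfun T x * derive1 (derive1 phi) x)%:E)%E).
Proof.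
move=> fmu fnu _ shT; split; first exact: counter_shadow_hull.
move=> phi tphi; apply: Pfun_second_derivative => //.
by have [_ [Tnu _]] := shT; exact: meas_le_finite_fm fnu.
Qed.
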